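(* Let $q\in(0,1]$, let $n\ge 0$ be an integer, and let $\mathcal{T}=\langle T_1,T_2,T_3\rangle$ be a nondegenerate triangle in $\mathbb{R}^2$. The set $$\mathcal{B}^n_q=\{B_{ijk}^n(u,v)\}_{i+j+k=n}$$ of triangular $q$-Bernstein polynomials of degree $n$ relative to $\mathcal{T}$ (indexed by all integers $i,j,k\ge 0$ with $i+j+k=n$), regarded as functions of $(x,y)\in\mathbb{R}^2$ through the barycentric coordinates $u,v$ of $(x,y)$ relative to $\mathcal{T}$, is a basis of the space $\mathbb{P}^n$ of real bivariate polynomials in $x,y$ of total degree less than or equal to $n$.
   Context: Let $T_i=(x_i,y_i)$, $i=1,2,3$, be the vertices of the nondegenerate triangle $\mathcal{T}$. Every point $P=(x,y)\in\mathbb{R}^2$ has a unique representation $P=uT_1+vT_2+wT_3$ with $u+v+w=1$; the numbers $u,v,w=1-u-v$ are the barycentric coordinates of $P$ relative to $\mathcal{T}$. For a real number $q>0$ and a natural number $r$, the $q$-integer is $[r]=1+q+\cdots+q^{r-1}$ (so $[r]=r$ if $q=1$, and $[0]=0$). The $q$-factorial is $[r]!=[r][r-1]\cdots[1]$ with $[0]!=1$. The $q$-binomial coefficient is $\genfrac{[}{]}{0pt}{}{i}{j}=\frac{[i]!}{[j]!\,[i-j]!}$ if $i\ge j\ge 0$, and $0$ otherwise. For integers $i,j,k\ge 0$ with $i+j+k=n$, the triangular $q$-Bernstein polynomial relative to $\mathcal{T}$ is $$B^n_{ijk}(u,v)=\genfrac{[}{]}{0pt}{}{n}{k}\binom{i+j}{i}u^iv^j\prod_{s=0}^{k-1}(1-q^su-q^sv),$$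 where an empty product equals $1$. *)

(* Defs.v *)
From mathcomp Require Import all_boot all_order all_algebra.
From mathcomp Require Import reals ring.
From mathcomp Require Import mpoly.

Set Implicit Arguments.
Unset Strict Implicit.
Unset Printing Implicit Defensive.

Import Order.TTheory GRing.Theory Num.Theory.
Local Open Scope ring_scope.

Definition qint (R : realType) (q : R) (r : nat) : R := \sum_(s < r) q ^+ s.

Definition qfact (R : realType) (q : R) (r : nat) : R :=
  \prod_(1 <= s < r.+1) qint q s.

Definition qbinom (R : realType) (q : R) (i j : nat) : R :=
  if (j <= i)%N then qfact q i / (qfact q j * qfact q (i - j)) else 0.

Definition qbernstein (R : realType) (q : R) (n i j k : nat) (u v : R) : R :=
  qbinom q n k * 'C(i + j, i)%:R * u ^+ i * v ^+ j *
  \prod_(s < k) (1 - q ^+ s * u - q ^+ s * v).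

(* Points of the plane are row vectors, with x = P 0 0 and y = P 0 1. *)

Definition nondegenerate_triangle (R : realType) (T1 T2 T3 : 'rV[R]_2) : Prop :=
  row_free (col_mx (T2 - T1) (T3 - T1)).

Definition barycentric (R : realType) (T1 T2 T3 P : 'rV[R]_2) (u v w : R) :
    Prop :=
  u + v + w = 1 /\ P = u *: T1 + v *: T2 + w *: T3.

Lemma barycentric_exists (R : realType) (T1 T2 T3 P : 'rV[R]_2) :
  nondegenerate_triangle T1 T2 T3 -> exists u v w, barycentric T1 T2 T3 P u v w.
Proof.
rewrite /nondegenerate_triangle row_free_unit => Mu.
pose d : 'rV_(1 + 1) := (P - T1) *m invmx (col_mx (T2 - T1) (T3 - T1)).
have dM : d *m col_mx (T2 - T1) (T3 - T1) = P - T1 by rewrite mulmxKV.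
move: dM; rewrite -[d]hsubmxK mul_row_col [lsubmx d]mx11_scalar.
rewrite [rsubmx d]mx11_scalar !mul_scalar_mx.
move: (lsubmx d 0 0) (rsubmx d 0 0) => v w /rowP dM.
exists (1 - v - w), v, w; split; first by ring.
apply/rowP => i; have := dM i; rewrite !mxE => e.
by rewrite -[LHS](subrK (T1 0 i)) -e; ring.
Qed.

Lemma barycentric_unique (R : realType) (T1 T2 T3 P : 'rV[R]_2)
    (u v w u' v' w' : R) :
  nondegenerate_triangle T1 T2 T3 ->
  barycentric T1 T2 T3 P u v w -> barycentric T1 T2 T3 P u' v' w' ->
  [/\ u = u', v = v' & w = w'].
Proof.
move=> nd [s1 ->] [s2 /rowP e].
suff /eq_row_mx [/rowP/(_ 0) ev /rowP/(_ 0) ew] :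
    row_mx (v%:M : 'M_1) (w%:M : 'M_1) = row_mx v'%:M w'%:M.
  move: ev ew; rewrite !mxE !eqxx !mulr1n => ev ew; split=> //.
  by apply: (addIr (v + w)); rewrite {2}ev {2}ew !addrA s1 s2.
apply: (row_free_inj nd); rewrite !mul_row_col !mul_scalar_mx.
apply/rowP => i; have := e i; rewrite !mxE.
have -> : u = 1 - v - w by rewrite -s1; ring.
have -> : u' = 1 - v' - w' by rewrite -s2; ring.
move=> {}e; apply: (addIr (T1 0 i)).
by transitivity ((1 - v - w) * T1 0 i + v * T2 0 i + w * T3 0 i);
  [ring | rewrite e; ring].
Qed.

(* Polynomials are taken as functions on the plane; msize p is the total
   degree of p plus one, and is 0 for p = 0. *)
Definition poly_le (R : realType) (n : nat) (f : 'rV[R]_2 -> R) : Prop :=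
  exists p : {mpoly R[2]}, (msize p <= n.+1)%N /\ forall P, f P = p.@[P 0].

Definition bindex (n : nat) : finType :=
  {t : 'I_n.+1 * 'I_n.+1 * 'I_n.+1 | t.1.1 + t.1.2 + t.2 == n}%N.

Definition is_basis (R : realType) (X : Type) (W : (X -> R) -> Prop)
    (I : finType) (b : I -> X -> R) : Prop :=
  [/\ forall t, W (b t),
      forall c : I -> R,
        (forall P, \sum_t c t * b t P = 0) -> forall t, c t = 0
    & forall f, W f -> exists c : I -> R, forall P, f P = \sum_t c t * b t P].

Definition qbernstein_family (R : realType) (q : R) (n : nat)
    (u v : 'rV[R]_2 -> R) (t : bindex n) (P : 'rV[R]_2) : R :=
  let: (i, j, k) := val t in qbernstein q n i j k (u P) (v P).
Arguments qbernstein_family {R} q n u v t P.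

(* Main.v *)
(** Both halves rest on the shape [u^i v^j Pi_k] of the basis functions, where
    [Pi_k = \prod_(s < k) (1 - q^s (u + v))], the scalar factors being nonzero.

    Spanning: since [1 = (1 - q^k u - q^k v) + q^k u + q^k v], the function
    [u^i v^j Pi_k] is a combination of [u^i v^j Pi_(k+1)], [u^(i+1) v^j Pi_k]
    and [u^i v^(j+1) Pi_k]. So the span in degree [n] lies in the span in
    degree [n+1], and multiplication by [u] or [v], hence by [x] or [y], maps
    the former into the latter; all monomials are thus reached from [1].

    Independence: at the point with coordinates [(a z, b z)] a vanishing
    combination is a polynomial [\sum_m g_m(a, b) z^m h_m(z)] in [z] with
    [h_m(0) = 1], where [g_m] collects the terms with [i + j = m]. Reading off
    coefficients by increasing [m] gives [g_m(a, b) = 0] for all [a], [b], and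
    [b = 1] then gives the vanishing of each coefficient. *)

Require Import Defs.
From mathcomp Require Import all_boot all_order all_algebra.
From mathcomp Require Import reals ring zify.
From mathcomp Require Import mpoly.
Set Implicit Arguments.
Unset Strict Implicit.

Import Order.TTheory GRing.Theory Num.Theory.
Local Open Scope ring_scope.

(** * Univariate polynomials and their coefficients *)

Lemma poly_fun_eq0 (R : numDomainType) (p : {poly R}) :
  (forall x, p.[x] = 0) -> p = 0.
Proof.
(* The first [size p] natural numbers are distinct in characteristic zero, which is one root more
   than a nonzero [p] may have. *)
move=> p0; apply: (@roots_geq_poly_eq0 _ p [seq i%:R | i <- iota 0 (size p)]).
- by apply/allP => x _; rewrite /root p0.
- by rewrite map_inj_uniq ?iota_uniq//; apply: mulrIn; rewrite oner_eq0.
- by rewrite size_map size_iota.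
Qed.

(** Strong induction on the index: in the coefficient of ['X^i], the terms below [i] vanish by
    induction, those above [i] do not contribute, and the term [i] contributes [a i] since [h i] has
    constant term 1. *)
Lemma graded_sum_eq0 (R : nzRingType) (N : nat) (a : 'I_N -> R)
    (h : 'I_N -> {poly R}) :
  (forall i, (h i)`_0 = 1) ->
  \sum_(i < N) 'X^i * (a i *: h i) = 0 -> forall i, a i = 0.
Proof.
move=> h1 s0 i; have [m] := ubnP (val i); elim: m i => // m IH i.
rewrite ltnS => im.
have /(congr1 (fun p : {poly R} => p`_i)) := s0.
rewrite coef0 coef_sum (bigD1 i)//= big1 => [|j ji].
  by rewrite addr0 coefXnM ltnn subnn coefZ h1 mulr1.
rewrite coefXnM; case: ltnP => // lij.
have {}lij : (j < i)%N by rewrite ltn_neqAle lij andbT.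
by rewrite IH ?(leq_trans lij)// scale0r coef0.
Qed.

(** * Functions of bounded total degree *)

Lemma poly_le_cst (R : realType) (n : nat) (c : R) : poly_le n (fun=> c).
Proof.
exists c%:MP; split=> [|P]; last by rewrite mevalC.
by rewrite msizeC; case: eqP.
Qed.

Lemma poly_le_coord (R : realType) (i : 'I_2) :
  poly_le 1 (fun P : 'rV[R]_2 => P 0 i).
Proof. by exists 'X_i; rewrite msizeX mdeg1; split=> // P; rewrite mevalXU. Qed.

Lemma poly_leD (R : realType) (n : nat) (f g : 'rV[R]_2 -> R) :
  poly_le n f -> poly_le n g -> poly_le n (fun P => f P + g P).
Proof.
move=> [p [sp fp]] [r [sr gr]]; exists (p + r); split=> [|P].
  by apply: leq_trans (msizeD_le _ _) _; rewrite geq_max sp.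
by rewrite mevalD fp gr.
Qed.

Lemma poly_leM (R : realType) (m n : nat) (f g : 'rV[R]_2 -> R) :
  poly_le m f -> poly_le n g -> poly_le (m + n) (fun P => f P * g P).
Proof.
move=> [p [sp fp]] [r [sr gr]]; exists (p * r); split=> [|P]; last first.
  by rewrite mevalM fp gr.
have [->|p0] := eqVneq p 0; first by rewrite mul0r msize0.
have [->|r0] := eqVneq r 0; first by rewrite mulr0 msize0.
by rewrite msizeM//; move: (leq_add sp sr); rewrite addSn addnS; case: addn.
Qed.

Lemma poly_leZ (R : realType) (n : nat) (c : R) (f : 'rV[R]_2 -> R) :
  poly_le n f -> poly_le n (fun P => c * f P).
Proof. exact: (@poly_leM _ 0 n _ _ (poly_le_cst 0 c)). Qed.

Lemma poly_leX (R : realType) (f : 'rV[R]_2 -> R) (k : nat) :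
  poly_le 1 f -> poly_le k (fun P => f P ^+ k).
Proof.
move=> lf; elim: k => [|k IH]; first exact: poly_le_cst.
have [p [sp fp]] := poly_leM lf IH.
by exists p; split=> // P; rewrite exprS fp.
Qed.

Lemma poly_le_prod (R : realType) (k : nat) (f : nat -> 'rV[R]_2 -> R) :
  (forall s, poly_le 1 (f s)) -> poly_le k (fun P => \prod_(s < k) f s P).
Proof.
move=> lf; elim: k => [|k [p [sp fp]]].
  have [p [sp fp]] := @poly_le_cst R 0 1.
  by exists p; split=> // P; rewrite -fp big_ord0.
have [r [sr gr]] : poly_le k.+1 (fun P => (\prod_(s < k) f s P) * f k P).
  by rewrite -addn1; apply: poly_leM => //; exists p.
by exists r; split=> // P; rewrite -gr big_ord_recr.
Qed.

(** The pair [(v, w)] holds the coordinates of [P - T1] in the basis [T2 - T1], [T3 - T1]. Inverting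
    the matrix of this basis makes [v] and [w] affine in [P], and then [u = 1 - v - w] is affine
    too. *)
Lemma barycentric_affine (R : realType) (T1 T2 T3 : 'rV[R]_2)
    (u v w : 'rV[R]_2 -> R) :
  nondegenerate_triangle T1 T2 T3 ->
  (forall P, barycentric T1 T2 T3 P (u P) (v P) (w P)) ->
  poly_le 1 u /\ poly_le 1 v.
Proof.
rewrite /nondegenerate_triangle row_free_unit => Mu bar.
set M := (col_mx _ _ : 'M_(1 + 1, 2)) in Mu.
have E P : row_mx (v P)%:M (w P)%:M = (P - T1) *m invmx M :> 'rV_(1 + 1).
  rewrite -[LHS](mulmxK Mu) mul_row_col !mul_scalar_mx; congr (_ *m _).
  have [s /rowP eP] := bar P; apply/rowP => i; rewrite !mxE eP !mxE.
  have -> : u P = 1 - v P - w P by rewrite -s; ring.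
  by ring.
have L (j : 'I_2) : poly_le 1 (fun P => ((P - T1) *m invmx M) 0 j).
  have [p [sp fp]] : poly_le 1 (fun P => invmx M 0 j * (P 0 0 + - T1 0 0)
      + invmx M 1 j * (P 0 1 + - T1 0 1)).
    by apply: poly_leD; apply: poly_leZ; apply: poly_leD;
      [exact: poly_le_coord | exact: poly_le_cst
      |exact: poly_le_coord | exact: poly_le_cst].
  exists p; split=> // P; rewrite -fp !mxE !big_ord_recl big_ord0 !mxE addr0.
  have -> : lift ord0 ord0 = 1 :> 'I_2 by exact/val_inj.
  by rewrite ![_ * (_ - _)]mulrC.
have Lv : poly_le 1 v.
  have [p [sp fp]] := L (lshift 1 (0 : 'I_1)); exists p; split=> // P.
  by rewrite -fp -E row_mxEl mxE eqxx.
have Lw : poly_le 1 w.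
  have [p [sp fp]] := L (rshift 1 (0 : 'I_1)); exists p; split=> // P.
  by rewrite -fp -E row_mxEr mxE eqxx.
split=> //.
have [p [sp fp]] := poly_leD (poly_le_cst 1 1)
  (poly_leD (poly_leZ (-1) Lv) (poly_leZ (-1) Lw)).
exists p; split=> // P.
by rewrite -fp !mulN1r addrA; have [<- _] := bar P; ring.
Qed.

Lemma qfact_neq0 (R : realType) (q : R) (r : nat) : 0 < q -> qfact q r != 0.
Proof.
move=> q0; rewrite prodf_seq_neq0; apply/allP => s.
rewrite mem_index_iota; case: s => // s _ /=; apply: lt0r_neq0.
rewrite /qint big_ord_recl expr0 ltr_wpDr ?ltr01// sumr_ge0// => i _.
by rewrite exprn_ge0// ltW.
Qed.

Lemma qbernstein_scalar_neq0 (R : realType) (q : R) (n i j k : nat) :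
  0 < q -> (i + j + k = n)%N -> qbinom q n k * 'C(i + j, i)%:R != 0 :> R.
Proof.
move=> q0 e; rewrite /qbinom -e leq_addl mulf_neq0//.
  by rewrite mulf_neq0 ?invr_neq0 ?mulf_neq0 ?qfact_neq0.
by rewrite pnatr_eq0 -lt0n bin_gt0 leq_addr.
Qed.

(** * Linear spans of finite families of functions *)

Definition in_span (R : realType) (X : Type) (I : finType) (b : I -> X -> R)
    (f : X -> R) : Prop :=
  exists c : I -> R, forall x, f x = \sum_t c t * b t x.

Section Span.
Context (R : realType) (X : Type) (I : finType) (b : I -> X -> R).

Lemma eq_in_span (f g : X -> R) : f =1 g -> in_span b f -> in_span b g.
Proof. by move=> fg [c fc]; exists c => x; rewrite -fg. Qed.

Lemma in_span_gen t : in_span b (b t).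
Proof.
exists (fun s => (s == t)%:R) => x; rewrite (bigD1 t)//= eqxx mul1r.
by rewrite big1 ?addr0// => s /negPf ->; rewrite mul0r.
Qed.

Lemma in_spanZ (a : R) (f : X -> R) :
  in_span b f -> in_span b (fun x => a * f x).
Proof.
move=> [c fc]; exists (fun t => a * c t) => x.
by rewrite fc mulr_sumr; apply: eq_bigr => t _; rewrite mulrA.
Qed.

Lemma in_spanD (f g : X -> R) :
  in_span b f -> in_span b g -> in_span b (fun x => f x + g x).
Proof.
move=> [c fc] [d gd]; exists (fun t => c t + d t) => x.
by rewrite fc gd -big_split; apply: eq_bigr => t _; rewrite mulrDl.
Qed.

Lemma in_span_sum (J : Type) (s : seq J) (F : J -> X -> R) (P : pred J) :
  (forall j, P j -> in_span b (F j)) ->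
  in_span b (fun x => \sum_(j <- s | P j) F j x).
Proof.
move=> hF; elim: s => [|j s IH].
  by exists (fun=> 0) => x; rewrite big_nil big1// => t _; rewrite mul0r.
case Pj: (P j); last by apply: eq_in_span IH => x; rewrite big_cons Pj.
by apply: eq_in_span (in_spanD (hF j Pj) IH) => x; rewrite big_cons Pj.
Qed.

End Span.

(** Freed of the scalar factor, the basis function no longer refers to [n], so different degrees can
    be compared. *)
Definition qmonomial (R : realType) (q : R) (i j k : nat) (u v : R) : R :=
  u ^+ i * v ^+ j * \prod_(s < k) (1 - q ^+ s * u - q ^+ s * v).

Lemma qbernstein_familyE (R : realType) (q : R) (n : nat)
    (u v : 'rV[R]_2 -> R) (t : bindex n) (P : 'rV[R]_2) :
  qbernstein_family q n u v t P =
  qbinom q n (val t).2 * 'C((val t).1.1 + (val t).1.2, (val t).1.1)%:R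
  * qmonomial q (val t).1.1 (val t).1.2 (val t).2 (u P) (v P).
Proof.
by rewrite /qbernstein_family; case: (val t) => [[i j] k]; rewrite !mulrA.
Qed.

(** * Spanning *)

Section Spanning.
Context (R : realType) (q : R) (u v : 'rV[R]_2 -> R) (q_gt0 : 0 < q).

Let S n := in_span (qbernstein_family q n u v).

Lemma in_span_qmonomial (n i j k : nat) : (i + j + k = n)%N ->
  S n (fun P => qmonomial q i j k (u P) (v P)).
Proof.
move=> e; have [ei ej ek] : [/\ i < n.+1, j < n.+1 & k < n.+1]%N.
  by split; rewrite ltnS -e ?leq_addl// -addnA ?leq_addr// addnCA leq_addr.
pose r : 'I_n.+1 * 'I_n.+1 * 'I_n.+1 := (inord i, inord j, inord k).
have re : (r.1.1 + r.1.2 + r.2 == n)%N by rewrite /= !inordK// e.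
pose t : bindex n := exist _ r re.
have := in_spanZ ((qbinom q n k * 'C(i + j, i)%:R)^-1)
  (in_span_gen (qbernstein_family q n u v) t).
apply: eq_in_span => P; rewrite qbernstein_familyE /= !inordK// mulKf//.
exact: qbernstein_scalar_neq0.
Qed.

(** Multiplication by [g] is linear, so it may be tested on generators. It serves with [g] equal to
    [u], to [v], and to 1 for the inclusion of spans. *)
Lemma in_span_qmonomial_ind (n m : nat) (g f : 'rV[R]_2 -> R) :
  (forall i j k, (i + j + k = n)%N ->
     S m (fun P => g P * qmonomial q i j k (u P) (v P))) ->
  S n f -> S m (fun P => g P * f P).
Proof.
move=> H [c fc].
have := @in_span_sum _ _ _ (qbernstein_family q m u v) _
  (index_enum (bindex n)) (fun t P => c t * (qbinom q n (val t).2
   * 'C((val t).1.1 + (val t).1.2, (val t).1.1)%:R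
   * (g P * qmonomial q (val t).1.1 (val t).1.2 (val t).2 (u P) (v P)))) xpredT.
have hF (t : bindex n) : true -> S m (fun P => c t * (qbinom q n (val t).2
   * 'C((val t).1.1 + (val t).1.2, (val t).1.1)%:R
   * (g P * qmonomial q (val t).1.1 (val t).1.2 (val t).2 (u P) (v P)))).
  by move=> _; do 2!apply: in_spanZ; apply: H; apply/eqP/(valP t).
move=> /(_ hF); apply: eq_in_span => P.
rewrite fc mulr_sumr; apply: eq_bigr => t _; rewrite qbernstein_familyE; ring.
Qed.

Lemma in_spanMu (n : nat) f : S n f -> S n.+1 (fun P => u P * f P).
Proof.
apply: in_span_qmonomial_ind => i j k e.
have := @in_span_qmonomial n.+1 i.+1 j k; rewrite -e => /(_ erefl).
by apply: eq_in_span => P; rewrite /qmonomial exprS !mulrA.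
Qed.

Lemma in_spanMv (n : nat) f : S n f -> S n.+1 (fun P => v P * f P).
Proof.
apply: in_span_qmonomial_ind => i j k e.
have := @in_span_qmonomial n.+1 i j.+1 k; rewrite -e addnS => /(_ erefl).
by apply: eq_in_span => P; rewrite /qmonomial exprS !mulrA (mulrC (v P)).
Qed.

Lemma in_spanS (n : nat) f : S n f -> S n.+1 f.
Proof.
move=> Sf; have : S n.+1 (fun P => 1 * f P).
  apply: in_span_qmonomial_ind Sf => i j k e.
  have H3 := @in_span_qmonomial n.+1 i j k.+1.
  have H1 := in_spanMu (in_span_qmonomial e).
  have H2 := in_spanMv (in_span_qmonomial e).
  rewrite addnS e in H3.
  (* The last factor of the product in [H3] is [1 - q^k (u + v)]; adding [q^k] times [H1] and [H2]
     restores 1. *)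
  have := in_spanD (H3 erefl) (in_spanZ (q ^+ k) (in_spanD H1 H2)).
  by apply: eq_in_span => P; rewrite /qmonomial big_ord_recr /=; ring.
by apply: eq_in_span => P; rewrite mul1r.
Qed.

Lemma in_span_leq (m n : nat) f : (m <= n)%N -> S m f -> S n f.
Proof.
move=> /subnK <-; elim: (n - m)%N => // k IH Sf.
by rewrite addSn; apply/in_spanS/IH.
Qed.

(** Eliminating [w] writes the coordinate as [T3 + (T1 - T3) u + (T2 - T3) v], taken at index [i];
    the constant term is handled by [in_spanS]. *)
Lemma in_span_coordM (T1 T2 T3 : 'rV[R]_2) (w : 'rV[R]_2 -> R) (n : nat)
    (i : 'I_2) f :
  (forall P, barycentric T1 T2 T3 P (u P) (v P) (w P)) ->
  S n f -> S n.+1 (fun P => P 0 i * f P).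
Proof.
move=> bar Sf.
have := in_spanD (in_spanZ (T3 0 i) (in_spanS Sf))
  (in_spanD (in_spanZ (T1 0 i - T3 0 i) (in_spanMu Sf))
            (in_spanZ (T2 0 i - T3 0 i) (in_spanMv Sf))).
apply: eq_in_span => P; have [s /rowP/(_ i)] := bar P.
rewrite !mxE => ->; have -> : w P = 1 - u P - v P by rewrite -s; ring.
by ring.
Qed.

Lemma in_span_coordXM (T1 T2 T3 : 'rV[R]_2) (w : 'rV[R]_2 -> R) (n m : nat)
    (i : 'I_2) f :
  (forall P, barycentric T1 T2 T3 P (u P) (v P) (w P)) ->
  S n f -> S (m + n) (fun P => P 0 i ^+ m * f P).
Proof.
move=> bar Sf; elim: m => [|m IH].
  by apply: eq_in_span Sf => P; rewrite mul1r.
apply: eq_in_span (in_span_coordM i bar IH) => P.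
by rewrite exprS mulrA.
Qed.

Lemma poly_le_in_span (T1 T2 T3 : 'rV[R]_2) (w : 'rV[R]_2 -> R) (n : nat) f :
  (forall P, barycentric T1 T2 T3 P (u P) (v P) (w P)) ->
  poly_le n f -> S n f.
Proof.
move=> bar [p [sp fp]].
have S1 : S 0 (fun=> 1).
  apply: eq_in_span (@in_span_qmonomial 0 0 0 0 erefl) => P.
  by rewrite /qmonomial big_ord0 !mulr1.
(* The redundant filter keeps membership in the support at hand, which bounds the degree of each
   monomial. *)
suff : S n (fun P => \sum_(m <- msupp p | m \in msupp p)
    p@_m * \prod_i P 0 i ^+ m i).
  by apply: eq_in_span => P; rewrite fp mevalE [RHS]big_seq.
apply: in_span_sum => m mp; apply: in_spanZ.
have := in_span_coordXM (m 0) 0 bar (in_span_coordXM (m 1) 1 bar S1).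
have m1 : lift ord0 ord0 = 1 :> 'I_2 by exact/val_inj.
(* Each monomial is built from 1 in its own degree, then lifted to degree [n]. *)
rewrite addn0 => Sm; apply: (@in_span_leq (m 0 + m 1)).
  have := leq_trans (msize_mdeg_lt mp) sp.
  by rewrite ltnS mdegE !big_ord_recl big_ord0 addn0 m1.
apply: eq_in_span Sm => P.
by rewrite !big_ord_recl big_ord0 m1.
Qed.

End Spanning.

(** * Linear independence *)

Section Independence.
Context (R : realType) (q : R) (n : nat) (d : bindex n -> R).

Hypothesis d_eq0 : forall x y : R, \sum_t d t *
  qmonomial q (val t).1.1 (val t).1.2 (val t).2 x y = 0.

(** Since [rev_ord m] is [n - m], the filter selects the terms with [i + j = m]. On the line
    [(a z, b z)] these share the factor [z^m] and the polynomial [h m] below. *)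
Lemma qmonomial_homogeneous (a b : R) (m : 'I_n.+1) :
  \sum_(t : bindex n | (val t).2 == rev_ord m)
     d t * a ^+ (val t).1.1 * b ^+ (val t).1.2 = 0.
Proof.
pose h (m : 'I_n.+1) : {poly R} :=
  \prod_(s < rev_ord m) (1 - (q ^+ s * (a + b)) *: 'X).
apply: (@graded_sum_eq0 _ _ (fun m : 'I_n.+1 =>
  \sum_(t : bindex n | (val t).2 == rev_ord m)
     d t * a ^+ (val t).1.1 * b ^+ (val t).1.2) h) => {m} [m|].
  rewrite -horner_coef0 horner_prod big1// => s _.
  by rewrite hornerD hornerN hornerZ hornerX hornerC mulr0 subr0.
apply: poly_fun_eq0 => z; rewrite -[RHS](d_eq0 (a * z) (b * z)).
rewrite (@partition_big _ _ _ _ _ _ _ (fun t : bindex n => rev_ord (val t).2)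
  xpredT)//= horner_sum.
apply: eq_bigr => m _; rewrite hornerM hornerXn hornerZ mulr_suml mulr_sumr.
apply: eq_big => [t|t].
  by rewrite -[RHS](inj_eq (@rev_ord_inj _)) rev_ordK.
move=> /eqP tm; rewrite /qmonomial /h horner_prod tm.
have -> : m = ((val t).1.1 + (val t).1.2)%N :> nat.
  have := eqP (valP t); have := ltn_ord m; rewrite tm /=; lia.
rewrite exprD !exprMn.
under eq_bigr do rewrite hornerD hornerN hornerZ hornerX hornerC.
under [in RHS]eq_bigr do rewrite -addrA -opprD -mulrDr -mulrDl mulrA.
by ring.
Qed.

(** With [b = 1] the homogeneous sum is a polynomial in [a]. Once [k] is fixed, [i] determines [j],
    so each power of [a] carries a single coefficient. *)
Lemma qmonomial_indep (t : bindex n) : d t = 0.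
Proof.
pose k := (val t).2.
have p0 : \sum_(s : bindex n | (val s).2 == k) d s *: 'X^((val s).1.1) = 0.
  apply: poly_fun_eq0 => a.
  have := qmonomial_homogeneous a 1 (rev_ord k); rewrite rev_ordK.
  rewrite horner_sum => e; rewrite -[RHS]e; apply: eq_bigr => s _.
  by rewrite hornerZ hornerXn expr1n mulr1.
have /(congr1 (fun p : {poly R} => p`_(val t).1.1)) := p0.
rewrite coef0 coef_sum (bigD1 t)//= big1 => [|s /andP[/eqP sk st]].
  by rewrite coefZ coefXn eqxx mulr1 addr0.
rewrite coefZ coefXn; case: eqP => [e|]; last by rewrite mulr0.
case/eqP: st; apply/val_inj.
have := eqP (valP t); have := eqP (valP s); move: sk e; rewrite /k /=.
case: (sval s) (sval t) => [[i j] k'] [[i' j'] k''] /= -> e.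
rewrite e => es et; congr (_, _, _); apply/val_inj => //=; lia.
Qed.

End Independence.

Theorem theorem5p2 (R : realType) (q : R) (n : nat)
    (T1 T2 T3 : 'rV[R]_2) (u v w : 'rV[R]_2 -> R) :
  0 < q <= 1 ->
  nondegenerate_triangle T1 T2 T3 ->
  (forall P, barycentric T1 T2 T3 P (u P) (v P) (w P)) ->
  is_basis (poly_le n) (qbernstein_family q n u v).
Proof.
move=> /andP[q0 _] nd bar; split=> [t|c c0 t|f].
- have [lu lv] := barycentric_affine nd bar.
  have lf s : poly_le 1 (fun P => 1 - q ^+ s * u P - q ^+ s * v P).
    have [p [sp fp]] := poly_leD (poly_le_cst 1 1)
      (poly_leD (poly_leZ (- q ^+ s) lu) (poly_leZ (- q ^+ s) lv)).
    by exists p; split=> // P; rewrite -fp; ring.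
  have [p [sp fp]] := poly_leZ
    (qbinom q n (val t).2 * 'C((val t).1.1 + (val t).1.2, (val t).1.1)%:R)
    (poly_leM (poly_leM (poly_leX (val t).1.1 lu) (poly_leX (val t).1.2 lv))
              (poly_le_prod (val t).2 lf)).
  exists p; rewrite (eqP (valP t)) in sp; split=> // P.
  by rewrite -fp qbernstein_familyE.
- pose a (t : bindex n) : R :=
    qbinom q n (val t).2 * 'C((val t).1.1 + (val t).1.2, (val t).1.1)%:R.
  (* The nonzero scalars are absorbed into the coefficients. *)
  suff /eqP : c t * a t = 0.
    by rewrite mulf_eq0 => /orP[/eqP//|]; apply: contraTeq => _;
      apply: qbernstein_scalar_neq0 => //; apply/eqP/(valP t).
  apply: (@qmonomial_indep _ q n (fun t => c t * a t)) => x y.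
  (* Every pair [(x, y)] is the value of [(u, v)] at some point, so a relation on the plane holds
     for all real [x] and [y]. *)
  pose P := x *: T1 + y *: T2 + (1 - x - y) *: T3.
  have barP : barycentric T1 T2 T3 P x y (1 - x - y) by split=> //; ring.
  have [<- <- _] := barycentric_unique nd (bar P) barP.
  rewrite -[RHS](c0 P); apply: eq_bigr => s _.
  by rewrite qbernstein_familyE mulrA.
- exact: (poly_le_in_span q0 bar).
Qed.
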